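(* Let $\ell$ be an odd prime, let $t\ge2$ be an integer, and let $\alpha\in\mathbb{Z}_\ell^t\setminus(\ell\mathbb{Z}_\ell)^t$ be an admissible vector. If $t<\ell$, then $\mu_\ell(X_t,\alpha)=0$.
   Context: For $b\in\mathbb{Z}_\ell$ put $\binom{b}{n}=\frac{b(b-1)\cdots(b-n+1)}{n!}\in\mathbb{Z}_\ell$ and $(1+T)^b=\sum_{n\ge0}\binom{b}{n}T^n\in\mathbb{Z}_\ell[[T]]$. The bouquet $X_t$ is the multigraph with one vertex and $t$ undirected loops; a vector $\alpha=(\alpha_1,\dots,\alpha_t)\in\mathbb{Z}_\ell^t$ assigns the voltage $\alpha_j$ to the $j$-th loop. It is admissible if $\alpha\in\mathbb{Z}_\ell^t\setminus(\ell\mathbb{Z}_\ell)^t$. The characteristic series is $$f(T)=f_{X_t,\alpha}(T)=\sum_{j=1}^t\big(2-(1+T)^{\alpha_j}-(1+T)^{-\alpha_j}\big)\in\mathbb{Z}_\ell[[T]].$$ For admissible $\alpha$ it is nonzero, and it has zero constant term. By Weierstrass preparation write $f(T)=\ell^{\mu}g(T)u(T)$ with $\mu\in\mathbb{Z}_{\ge0}$, $g$ a distinguished polynomial (monic, all non-leading coefficients divisible by $\ell$) and $u\in\mathbb{Z}_\ell[[T]]^\times$. Then $\mu_\ell(X_t,\alpha):=\mu$ and $\lambda_\ell(X_t,\alpha):=\deg g-1$. *)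

(* Defs.v *)
From HB Require Import structures.
From mathcomp Require Import all_boot all_order all_algebra.
From mathcomp Require Import boolp.

Set Implicit Arguments.
Unset Strict Implicit.
Unset Printing Implicit Defensive.
Import GRing.Theory.
Local Open Scope ring_scope.

(* Z_l as the inverse limit of the rings Z/l^(n+1), for l prime. 'Z_m is Z/m  *)
(* only for m > 1, whence the exponent n.+1; as 'Z_m is never the zero ring,  *)
(* no proof that l is prime is needed for the ring structure.                 *)
Record padic_int (l : nat) := PadicInt {
  pres : forall n, 'Z_(l ^ n.+1);
  pres_compat : forall n, inZp (pres n.+1) = pres n }.

Section PadicRing.
Variable l : nat.
Implicit Types x y z : padic_int l.

HB.instance Definition _ := gen_eqMixin (padic_int l).
HB.instance Definition _ := gen_choiceMixin (padic_int l).

Lemma padicP x y : (forall n, pres x n = pres y n) -> x = y.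
Proof.
case: x y => [x xP] [y yP] /= exy.
have {}exy : x = y by apply: functional_extensionality_dep.
by case: y / exy yP => yP; congr PadicInt; apply: Prop_irrelevance.
Qed.

Lemma Zp_trunc_dvd n :
  ((Zp_trunc (l ^ n.+1)).+2 %| (Zp_trunc (l ^ n.+2)).+2)%N.
Proof.
case: l => [|[|k]]; first by rewrite !exp0n.
  by rewrite !exp1n.
have gt1 m : (1 < k.+2 ^ m.+1)%N by apply: leq_ltn_trans (ltn_expl m.+1 _).
by rewrite !Zp_cast ?dvdn_exp2l.
Qed.

Definition ptrunc n (a : 'Z_(l ^ n.+2)) : 'Z_(l ^ n.+1) := inZp a.

Lemma ptruncD n : {morph @ptrunc n : a b / a + b}.
Proof.
by move=> a b; apply: val_inj; rewrite /= modnDm modn_dvdm // Zp_trunc_dvd.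
Qed.

Lemma ptruncM n : {morph @ptrunc n : a b / a * b}.
Proof.
by move=> a b; apply: val_inj; rewrite /= modnMm modn_dvdm // Zp_trunc_dvd.
Qed.

Lemma ptrunc0 n : @ptrunc n 0 = 0.
Proof. by apply: val_inj; rewrite /= mod0n. Qed.

Lemma ptrunc1 n : @ptrunc n 1 = 1.
Proof. by apply: val_inj. Qed.

Lemma ptruncN n : {morph @ptrunc n : a / - a}.
Proof.
by move=> a; apply/eqP; rewrite -subr_eq0 opprK -ptruncD addNr ptrunc0.
Qed.

Definition padic_zero := @PadicInt l (fun=> 0) ptrunc0.
Definition padic_one := @PadicInt l (fun=> 1) ptrunc1.

Fact padic_add_compat x y n :
  @ptrunc n (pres x n.+1 + pres y n.+1) = pres x n + pres y n.
Proof. by rewrite ptruncD /ptrunc !pres_compat. Qed.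
Definition padic_add x y :=
  @PadicInt l (fun n => pres x n + pres y n) (padic_add_compat x y).

Fact padic_mul_compat x y n :
  @ptrunc n (pres x n.+1 * pres y n.+1) = pres x n * pres y n.
Proof. by rewrite ptruncM /ptrunc !pres_compat. Qed.
Definition padic_mul x y :=
  @PadicInt l (fun n => pres x n * pres y n) (padic_mul_compat x y).

Fact padic_opp_compat x n : @ptrunc n (- pres x n.+1) = - pres x n.
Proof. by rewrite ptruncN /ptrunc pres_compat. Qed.
Definition padic_opp x :=
  @PadicInt l (fun n => - pres x n) (padic_opp_compat x).

Fact padic_addA : associative padic_add.
Proof. by move=> x y z; apply: padicP => n /=; rewrite addrA. Qed.
Fact padic_addC : commutative padic_add.
Proof. by move=> x y; apply: padicP => n /=; rewrite addrC. Qed.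
Fact padic_add0 : left_id padic_zero padic_add.
Proof. by move=> x; apply: padicP => n /=; rewrite add0r. Qed.
Fact padic_addN : left_inverse padic_zero padic_opp padic_add.
Proof. by move=> x; apply: padicP => n /=; rewrite addNr. Qed.
HB.instance Definition _ := GRing.isZmodule.Build (padic_int l)
  padic_addA padic_addC padic_add0 padic_addN.

Fact padic_mulA : associative padic_mul.
Proof. by move=> x y z; apply: padicP => n /=; rewrite mulrA. Qed.
Fact padic_mulC : commutative padic_mul.
Proof. by move=> x y; apply: padicP => n /=; rewrite mulrC. Qed.
Fact padic_mul1 : left_id padic_one padic_mul.
Proof. by move=> x; apply: padicP => n /=; rewrite mul1r. Qed.
Fact padic_mulD : left_distributive padic_mul padic_add.
Proof. by move=> x y z; apply: padicP => n /=; rewrite mulrDl. Qed.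
Fact padic_one_neq0 : padic_one != 0.
Proof. by apply/eqP=> /(congr1 (fun x => pres x 0)). Qed.
HB.instance Definition _ := GRing.Zmodule_isComNzRing.Build (padic_int l)
  padic_mulA padic_mulC padic_mul1 padic_mulD padic_one_neq0.

Lemma presD x y n : pres (x + y) n = pres x n + pres y n. Proof. by []. Qed.
Lemma presN x n : pres (- x) n = - pres x n. Proof. by []. Qed.
Lemma presM x y n : pres (x * y) n = pres x n * pres y n. Proof. by []. Qed.
Lemma pres1 n : pres (1 : padic_int l) n = 1. Proof. by []. Qed.
Lemma pres_nat m n : pres (m%:R : padic_int l) n = m%:R.
Proof. by elim: m => // m IH; rewrite -natr1 presD IH -natr1. Qed.

End PadicRing.

(* Formal power series R[[T]], with the Cauchy product.                       *)
Record fpseries (R : Type) := FPSeries { scoef : nat -> R }.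

Section SeriesRing.
Variable R : comNzRingType.
Implicit Types f g h : fpseries R.

HB.instance Definition _ := gen_eqMixin (fpseries R).
HB.instance Definition _ := gen_choiceMixin (fpseries R).

Lemma seriesP f g : (forall n, scoef f n = scoef g n) -> f = g.
Proof. by case: f g => [f] [g] /= /funext ->. Qed.

Definition series_of (p : {poly R}) := FPSeries (fun n => p`_n).
Definition series_add f g := FPSeries (fun n => scoef f n + scoef g n).
Definition series_opp f := FPSeries (fun n => - scoef f n).
Definition series_mul f g :=
  FPSeries (fun n => \sum_(i < n.+1) scoef f i * scoef g (n - i)).

Fact series_addA : associative series_add.
Proof. by move=> f g h; apply: seriesP => n /=; rewrite addrA. Qed.
Fact series_addC : commutative series_add.
Proof. by move=> f g; apply: seriesP => n /=; rewrite addrC. Qed.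
Fact series_add0 : left_id (FPSeries (fun=> 0)) series_add.
Proof. by move=> f; apply: seriesP => n /=; rewrite add0r. Qed.
Fact series_addN : left_inverse (FPSeries (fun=> 0)) series_opp series_add.
Proof. by move=> f; apply: seriesP => n /=; rewrite addNr. Qed.
HB.instance Definition _ := GRing.isZmodule.Build (fpseries R)
  series_addA series_addC series_add0 series_addN.

Definition strunc m f : {poly R} := \poly_(i < m) scoef f i.

Lemma coef_strunc m f n : (n < m)%N -> (strunc m f)`_n = scoef f n.
Proof. by move=> ltnm; rewrite coef_poly ltnm. Qed.

Lemma coef_struncM m f g n : (n < m)%N ->
  (strunc m f * strunc m g)`_n = scoef (series_mul f g) n.
Proof.
move=> ltnm; rewrite coefM; apply: eq_bigr => i _.
by rewrite !coef_strunc // (leq_ltn_trans _ ltnm) ?leq_subr // -ltnS.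
Qed.

Fact series_mulA : associative series_mul.
Proof.
move=> f g h; apply: seriesP => n.
transitivity ((strunc n.+1 f * strunc n.+1 g * strunc n.+1 h)`_n).
  rewrite -mulrA coefM; apply: eq_bigr => i _.
  by rewrite coef_strunc // coef_struncM // ltnS leq_subr.
by rewrite coefM; apply: eq_bigr => i _;
  rewrite coef_struncM // coef_strunc // ltnS leq_subr.
Qed.

Fact series_mulC : commutative series_mul.
Proof.
by move=> f g; apply: seriesP => n; rewrite -!(@coef_struncM n.+1) // mulrC.
Qed.

Fact series_mul1 : left_id (series_of 1) series_mul.
Proof.
move=> f; apply: seriesP => n /=.
rewrite big_ord_recl /= coef1 mul1r subn0 big1 ?addr0 // => i _.
by rewrite coef1 mul0r.
Qed.

Fact series_mulD : left_distributive series_mul series_add.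
Proof.
move=> f g h; apply: seriesP => n /=; rewrite -big_split /=.
by apply: eq_bigr => i _; rewrite mulrDl.
Qed.

Fact series_one_neq0 : series_of 1 != 0.
Proof.
apply/eqP => /(congr1 (fun f => scoef f 0)) /=.
by rewrite coef1; apply/eqP/oner_neq0.
Qed.
HB.instance Definition _ := GRing.Zmodule_isComNzRing.Build (fpseries R)
  series_mulA series_mulC series_mul1 series_mulD series_one_neq0.

Lemma scoefD f g n : scoef (f + g) n = scoef f n + scoef g n.
Proof. by []. Qed.
Lemma scoefN f n : scoef (- f) n = - scoef f n. Proof. by []. Qed.
Lemma scoefM f g n :
  scoef (f * g) n = \sum_(i < n.+1) scoef f i * scoef g (n - i).
Proof. by []. Qed.
Lemma scoef1 n : scoef (1 : fpseries R) n = (n == 0)%:R.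
Proof. exact: coef1. Qed.
Lemma scoefMn f m n : scoef (f *+ m) n = scoef f n *+ m.
Proof. by elim: m => // m IH; rewrite !mulrSr scoefD IH. Qed.

End SeriesRing.

Section MuInvariant.
Variable l : nat.
Local Notation Zl := (padic_int l).

(* n! is not a zero divisor in Z_l and divides the product (see padic_binP),  *)
(* so the choice below is that of a unique element.                           *)
Definition padic_bin (b : Zl) (n : nat) : Zl :=
  if pselect (exists c : Zl, n`!%:R * c = \prod_(i < n) (b - i%:R))
  is left ex then projT1 (cid ex) else 0.

(* (1+T)^b *)
Definition binseries (b : Zl) : fpseries Zl := FPSeries (padic_bin b).

Definition padic_dvd_l (x : Zl) := exists y : Zl, x = l%:R * y.

(* alpha is not in (l Z_l)^t *)
Definition admissible t (alpha : 'rV[Zl]_t) :=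
  ~ (forall j, padic_dvd_l (alpha 0 j)).

Definition char_series t (alpha : 'rV[Zl]_t) : fpseries Zl :=
  \sum_(j < t)
    (2 - binseries (alpha 0 j) - binseries (- alpha 0 j)).

Definition distinguished (g : {poly Zl}) :=
  g \is monic /\ forall i, (i < (size g).-1)%N -> padic_dvd_l g`_i.

Definition series_unit (u : fpseries Zl) := exists v : fpseries Zl, u * v = 1.

Definition weierstrass (f : fpseries Zl) (m : nat) (g : {poly Zl})
    (u : fpseries Zl) :=
  [/\ distinguished g, series_unit u & f = l%:R ^+ m * series_of g * u].

(* The exponent m is unique (see mu_seriesP); None means that f has no such   *)
(* factorization, as happens for f = 0.                                       *)
Definition mu_series (f : fpseries Zl) : option nat :=
  if pselect (exists m, exists g u, weierstrass f m g u) is left ex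
  then Some (projT1 (cid ex)) else None.

(* mu_l(X_t, alpha), where the bouquet X_t is determined by its number t of   *)
(* loops and alpha is the vector of their voltages.                           *)
Definition mu_bouquet t (alpha : 'rV[Zl]_t) := mu_series (char_series alpha).

End MuInvariant.

Section WellDefined.
Variable l : nat.
Hypothesis l_prime : prime l.
Local Notation Zl := (padic_int l).

Let l_gt1 n : (1 < l ^ n.+1)%N.
Proof. exact: leq_ltn_trans (ltn_expl n.+1 (prime_gt1 l_prime)). Qed.

Lemma Zp_eq_nat n a b :
  (a%:R == b%:R :> 'Z_(l ^ n.+1)) = (a == b %[mod l ^ n.+1]).
Proof. by rewrite -val_eqE /= !val_Zp_nat. Qed.

Lemma pres_natE (x : Zl) n k :
  (n <= k)%N -> pres x n = (pres x k : nat)%:R.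
Proof.
elim: k => [|k IH]; first by rewrite leqn0 => /eqP ->; rewrite natr_Zp.
rewrite leq_eqVlt => /orP[/eqP -> | ltnk]; first by rewrite natr_Zp.
rewrite (IH ltnk) -(pres_compat x k) /=; apply/eqP.
rewrite Zp_eq_nat; apply/eqP.
by rewrite modn_dvdm // Zp_cast // dvdn_exp2l.
Qed.

(* n a = n b mod l^(k + v_l(n) + 1) implies a = b mod l^(k + 1)               *)
Lemma eqmod_cancel n k a b : (0 < n)%N ->
  n * a = n * b %[mod l ^ (k + logn l n).+1] -> a = b %[mod l ^ k.+1].
Proof.
move=> n_gt0; wlog leab : a b / (a <= b)%N => [W E|].
  by case: (leqP a b) => [|/ltnW] /W; [apply | move=> ->].
move/eqP; rewrite eq_sym eqn_mod_dvd ?leq_mul2l ?leab ?orbT // -mulnBr => d.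
apply/esym/eqP; rewrite eqn_mod_dvd //.
have [->|nz] := posnP (b - a)%N; first by rewrite dvdn0.
move: d; rewrite !pfactor_dvdn // ?muln_gt0 ?n_gt0 //.
by rewrite lognM // -addSn addnC leq_add2l.
Qed.

Lemma padic_natI n (x y : Zl) : (0 < n)%N -> n%:R * x = n%:R * y -> x = y.
Proof.
move=> n_gt0 E; apply: padicP => k.
rewrite !(@pres_natE _ k (k + logn l n)) ?leq_addr //.
apply/eqP; rewrite Zp_eq_nat; apply/eqP/(eqmod_cancel n_gt0)/eqP.
rewrite -Zp_eq_nat !natrM !natr_Zp -!(pres_nat l n) -!presM.
by rewrite E.
Qed.

Lemma prod_natB (R : comNzRingType) N n :
  \prod_(i < n) (N%:R - i%:R) = (N ^_ n)%:R :> R.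
Proof.
elim: n => [|n IH]; first by rewrite big_ord0 ffactn0.
rewrite big_ord_recr /= IH ffactnSr natrM.
have [leNn|ltNn] := leqP n N; first by rewrite natrB.
by rewrite ffact_small // !mul0r.
Qed.

Lemma pres_prod (b : Zl) n k N : pres b k = N%:R ->
  pres (\prod_(i < n) (b - i%:R)) k = (n`! * 'C(N, n))%:R.
Proof.
move=> bN; rewrite mulnC bin_ffact -prod_natB.
elim: n => [|n IH]; first by rewrite !big_ord0.
rewrite !big_ord_recr presM; congr (_ * _); first exact: IH.
by rewrite presD presN pres_nat bN.
Qed.

Lemma padic_binP (b : Zl) n :
  n`!%:R * padic_bin b n = \prod_(i < n) (b - i%:R).
Proof.
rewrite /padic_bin; case: pselect => [ex|]; first exact: projT2 (cid ex).
case; set e := logn l n`!.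
pose c k : 'Z_(l ^ k.+1) := 'C(pres b (k + e)%N, n)%:R.
have cP k : inZp (c k.+1) = c k.
  rewrite -Zp_nat /c; apply/eqP.
  rewrite Zp_eq_nat val_Zp_nat // modn_dvdm ?dvdn_exp2l // addSn.
  apply/eqP/(eqmod_cancel (fact_gt0 n))/eqP.
  rewrite -Zp_eq_nat -/e.
  by rewrite -!(pres_prod n (b := b)) ?natr_Zp // -pres_natE.
exists (PadicInt cP); apply: padicP => k.
rewrite presM pres_nat /= /c -natrM -(pres_prod n (b := b)) //.
by rewrite -pres_natE ?leq_addr.
Qed.

Lemma weierstrass_mu_uniq (f : fpseries Zl) m m' g g' u u' :
  weierstrass f m g u -> weierstrass f m' g' u' -> m = m'.
Proof.
wlog lemm : m m' g g' u u' / (m <= m')%N => [W P Q|].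
  by case: (leqP m m') => [|/ltnW] le; [|apply/esym]; apply: W le _ _; eassumption.
move=> [[gm _] [v uv] ->] [_ _ E]; move: lemm; rewrite leq_eqVlt.
case/orP => [/eqP //|ltmm]; exfalso.
pose w : fpseries Zl := l%:R ^+ (m' - m.+1) * series_of g' * u' * v.
have {}E : l%:R ^+ m * series_of g = l%:R ^+ m * (l%:R * w).
  have {}E := congr1 ( *%R^~ v) E; rewrite -mulrA uv mulr1 in E.
  rewrite E /w !mulrA; do 3 congr (_ * _).
  by rewrite -exprSr -exprD subnKC.
have natE k (h : fpseries Zl) n : scoef (k%:R * h) n = k%:R * scoef h n.
  by rewrite mulr_natl scoefMn mulr_natl.
have {}E : 1 = l%:R * scoef w (size g).-1.
  apply: (@padic_natI (l ^ m)); first by rewrite expn_gt0 prime_gt0.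
  rewrite -[X in _ * X = _](monicP gm) -!natE (natrX (fpseries Zl)) -E.
  by rewrite -natrX natE.
have /(congr1 (fun x : Zl => pres x 0)) := E.
rewrite presM pres_nat -[X in X%:R]expn1 pchar_Zp // mul0r.
Qed.

Lemma mu_seriesP (f : fpseries Zl) m :
  mu_series f = Some m <-> exists g u, weierstrass f m g u.
Proof.
rewrite /mu_series; case: pselect => [ex|nex]; last first.
  by split=> // fm; case: nex; exists m.
case: (cid ex) => m' /= [g' [u' fm']]; split=> [[<-]|]; first by exists g', u'.
by move=> [g [u fm]]; rewrite (weierstrass_mu_uniq fm' fm).
Qed.

End WellDefined.

(* Main.v *)
Require Import Defs.
From mathcomp Require Import all_boot all_order all_algebra.
From mathcomp Require Import cyclic boolp ring.

(** Modulo l, the vanishing of the coefficients of f says that the functional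
    L(p) = sum_j (2 p(0) - p(a_j) - p(-a_j)), where a_j is the residue of
    alpha_j, kills the falling factorials, hence all polynomials over Z/l.
    By Fermat L(X^(l-1)) = -2 c, where c is the number of j with a_j != 0; as
    0 < c <= t < l and l is odd, this is not 0.  Hence f has a coefficient prime
    to l, and Weierstrass preparation gives f = g u without a power of l. *)

(** * Formal power series: inverses and shifts; monic polynomial bases *)

Section PowerSeries.
Local Set Implicit Arguments.
Local Unset Strict Implicit.
Import GRing.Theory.
Local Open Scope ring_scope.
Variable R : comNzRingType.
Implicit Types f g h : fpseries R.

(** Since [h] has no constant term, coefficient [n] of [h * g] involves only the coefficients of [g]
    below [n], so iterating from 1 freezes coefficient [n] after [n] steps. The fixed point is the
    inverse of [1 - h]. *)
Lemma series_fixpoint (h : fpseries R) :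
  scoef h 0 = 0 -> exists g, g = 1 + h * g.
Proof.
move=> h0; pose x m := iter m (fun g => 1 + h * g) 1.
have scoef_h g n :
    scoef (h * g) n = \sum_(i < n) scoef h i.+1 * scoef g (n - i.+1).
  by rewrite scoefM big_ord_recl h0 mul0r add0r.
have xS m n : (n <= m)%N -> scoef (x m.+1) n = scoef (x m) n.
  elim: m n => [|m IH] n le_nm.
    by move: le_nm; rewrite leqn0 => /eqP ->; rewrite scoefD scoef_h big_ord0 addr0.
  rewrite [x m.+2]/= [x m.+1]/= !scoefD !scoef_h; congr (_ + _).
  apply: eq_bigr => i _; congr (_ * _); apply: IH.
  by rewrite leq_subLR addSn (leq_trans le_nm) // ltnS leq_addl.
have x_stable m n : (n <= m)%N -> scoef (x m) n = scoef (x n) n.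
  elim: m => [|m IH]; first by rewrite leqn0 => /eqP ->.
  rewrite leq_eqVlt => /orP[/eqP -> //|]; rewrite ltnS => le_nm.
  by rewrite xS // IH.
exists (FPSeries (fun n => scoef (x n) n)); apply: seriesP => n.
rewrite -[LHS]/(scoef (x n) n) -xS // [x n.+1]/= !scoefD !scoef_h; congr (_ + _).
by apply: eq_bigr => i _; rewrite /= (x_stable n) ?leq_subr.
Qed.

(** The series [1 - f * C] has no constant term, so its fixed point [g] inverts [f * C]. *)
Lemma series_inv (f : fpseries R) c :
  scoef f 0 * c = 1 -> exists g, f * g = 1.
Proof.
move=> f0c; pose C : fpseries R := series_of c%:P.
have [|g gE] := @series_fixpoint (1 - f * C).
  by rewrite scoefD scoefN scoefM big_ord1 /= coef1 coefC /= f0c subrr.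
exists (C * g); rewrite mulrA; move: gE.
by rewrite mulrBl mul1r addrCA -[LHS]addr0 => /addrI/esym/eqP;
  rewrite subr_eq0 => /eqP.
Qed.

(** The tail operator of Manin's proof of Weierstrass division. *)
Definition sshift n f : fpseries R := FPSeries (fun i => scoef f (n + i)).

Lemma scoef_mulXn n h i :
  scoef (series_of 'X^n * h) i = if (i < n)%N then 0 else scoef h (i - n).
Proof.
rewrite scoefM; have [lt_in|le_ni] := ltnP i n.
  rewrite big1 // => -[j /= lt_j] _.
  by rewrite coefXn ltn_eqF ?mul0r // (leq_trans lt_j).
rewrite (bigD1 (Ordinal (le_ni : n < i.+1)%N)) //= coefXn eqxx mul1r.
rewrite big1 ?addr0 // => j.
by rewrite -val_eqE coefXn /= => /negPf ->; rewrite mul0r.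
Qed.

(** Subtracting from [p] its leading coefficient times the [B k] of the same degree lowers the
    degree; monicity avoids any division. This carries the vanishing of a linear functional from
    falling factorials to all polynomials. *)
Lemma monic_basis_ind (B : nat -> {poly R}) (P : {poly R} -> Prop) :
  (forall k, B k \is monic) -> (forall k, size (B k) = k.+1) -> P 0 ->
  (forall a p q, P p -> P q -> P (a *: p + q)) -> (forall k, P (B k)) ->
  forall p, P p.
Proof.
move=> Bm Bs P0 Plin PB p.
have [n] := ubnP (size p); elim: n p => // n IH p; rewrite ltnS => le_pn.
have [->//|nz_p] := eqVneq p 0; pose k := (size p).-1.
have sk : size p = k.+1 by rewrite prednK // lt0n size_poly_eq0.
rewrite -(subrK (p`_k *: B k) p) addrC; apply: Plin => //; apply: IH.
apply: leq_trans le_pn; rewrite sk ltnS; apply/leq_sizeP => i.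
rewrite coefB coefZ leq_eqVlt => /orP[/eqP <-|lt_ki].
  by have := monicP (Bm k); rewrite lead_coefE Bs => ->; rewrite mulr1 subrr.
by rewrite [p`_i]nth_default ?sk // [(B k)`_i]nth_default ?Bs // mulr0 subrr.
Qed.

End PowerSeries.

(** * Divisibility, units and completeness of the l-adic integers *)

Section PadicIntegers.
Local Set Implicit Arguments.
Local Unset Strict Implicit.
Import GRing.Theory.
Local Open Scope ring_scope.
Variable l : nat.
Hypothesis l_prime : prime l.
Local Notation Zl := (padic_int l).
Implicit Types x y : Zl.

Lemma expn_prime_gt1 n : (1 < l ^ n.+1)%N.
Proof. exact: leq_ltn_trans (ltn_expl n.+1 (prime_gt1 l_prime)). Qed.

Lemma pres_sum (I : Type) (r : seq I) (F : I -> Zl) n :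
  pres (\sum_(i <- r) F i) n = \sum_(i <- r) pres (F i) n.
Proof. by elim/big_rec2: _ => [//|i y1 y2 _ <-]; rewrite presD. Qed.

Lemma padic_dvd_lP x : pres x 0 = 0 -> padic_dvd_l x.
Proof.
move=> x0.
have ldiv k : (l %| pres x k)%N.
  have := @pres_natE l l_prime x 0 k (leq0n k); rewrite x0 => /esym/eqP.
  by rewrite -[0]/(0%:R) (Zp_eq_nat l_prime) expn1 mod0n.
(* Dividing by [l] loses one digit, so level [k] of the quotient is read off level [k.+1] of [x]. *)
pose y k : 'Z_(l ^ k.+1) := (pres x k.+1 %/ l)%:R.
have yP k : inZp (y k.+1) = y k.
  rewrite -Zp_nat /y; apply/eqP; rewrite (Zp_eq_nat l_prime).
  rewrite val_Zp_nat ?expn_prime_gt1 // modn_dvdm ?dvdn_exp2l //.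
  apply/eqP/(@eqmod_cancel l l_prime l k); first exact: prime_gt0.
  rewrite logn_prime // eqxx addn1 ![(l * _)%N]mulnC !divnK ?ldiv //.
  apply/eqP; rewrite -(Zp_eq_nat l_prime) natr_Zp.
  by rewrite -pres_natE.
exists (PadicInt yP); apply: padicP => k.
rewrite presM pres_nat /= /y -natrM mulnC divnK //.
by rewrite -pres_natE.
Qed.

(** If [x] is nonzero modulo [l], all its residues are prime to [l]; uniqueness of inverses makes
    the levelwise inverses compatible. *)
Lemma padic_unitP x : pres x 0 != 0 -> exists y, x * y = 1.
Proof.
move=> x0.
have ux k : pres x k \is a GRing.unit.
  rewrite -[pres x k]natr_Zp unitZpE ?expn_prime_gt1 //.
  rewrite coprimeXl // prime_coprime //; apply: contra x0 => dv.
  rewrite (@pres_natE l l_prime x 0 k) // -[0]/(0%:R) (Zp_eq_nat l_prime).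
  by rewrite expn1 mod0n.
have yP k : inZp (pres x k.+1)^-1 = (pres x k)^-1.
  apply/esym/mulr1_eq; rewrite -(pres_compat x k).
  rewrite -[LHS]/(ptrunc (pres x k.+1) * ptrunc (pres x k.+1)^-1).
  by rewrite -ptruncM (mulrV (ux k.+1)) ptrunc1.
by exists (PadicInt yP); apply: padicP => k; rewrite presM /= (mulrV (ux k)).
Qed.

(** Multiplication by [l] gains one digit of agreement, which is the source of the contraction
    below. *)
Lemma pres_mul_l x y k : pres x k = pres y k ->
  pres (l%:R * x) k.+1 = pres (l%:R * y) k.+1.
Proof.
rewrite (@pres_natE l l_prime x k k.+1) // (@pres_natE l l_prime y k k.+1) //.
move/eqP; rewrite (Zp_eq_nat l_prime) => /eqP E.
rewrite !presM pres_nat -[pres x _]natr_Zp -[pres y _]natr_Zp -!natrM.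
apply/eqP; rewrite (Zp_eq_nat l_prime).
move: (pres x k.+1 : nat) (pres y k.+1 : nat) E => N M E.
by rewrite expnS -!muln_modr E.
Qed.

Lemma pres_mul_l0 x : pres (l%:R * x) 0 = 0.
Proof. by rewrite presM pres_nat -[X in X%:R]expn1 pchar_Zp ?mul0r ?expn_prime_gt1. Qed.

(** Completeness in diagonal form: the limit takes its level [k] from the [k]-th term. *)
Lemma padic_limit (x : nat -> Zl) :
  (forall k, pres (x k.+1) k = pres (x k) k) ->
  exists y, forall k, pres y k = pres (x k) k.
Proof.
move=> xS; pose y k := pres (x k) k.
have yP k : inZp (y k.+1) = y k by rewrite /y pres_compat xS.
by exists (PadicInt yP).
Qed.

(** * Weierstrass preparation *)

Lemma scoef_natM m (h : fpseries Zl) n :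
  scoef (m%:R * h) n = m%:R * scoef h n.
Proof. by rewrite mulr_natl scoefMn mulr_natl. Qed.

(* [z |-> 1 - l * sshift n (z * B)] contracts the l-adic topology. *)
Lemma sshift_fixpoint n (B : fpseries Zl) :
  exists z, z = 1 - l%:R * sshift n (z * B).
Proof.
pose F z : fpseries Zl := 1 - l%:R * sshift n (z * B).
pose agree k (z w : fpseries Zl) :=
  forall i, pres (scoef z i) k = pres (scoef w i) k.
have agreeM k z w : agree k z w -> agree k (sshift n (z * B)) (sshift n (w * B)).
  move=> zw i; rewrite /= !pres_sum; apply: eq_bigr => j _.
  by rewrite !presM zw.
have Fcontr k z w : agree k z w -> agree k.+1 (F z) (F w).
  move=> /agreeM zw i; rewrite /F !scoefD !scoefN !scoef_natM !presD !presN.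
  by congr (_ - _); apply: pres_mul_l.
(* [F] also preserves agreement at a fixed level, which lets the equation pass to the limit. *)
have Fweak k z w : agree k z w -> agree k (F z) (F w).
  move=> /agreeM zw i; rewrite /F !scoefD !scoefN !scoef_natM !presD !presN.
  by rewrite !presM zw.
pose x m := iter m F 1.
have xS k : agree k (x k.+1) (x k).
  elim: k => [|k IH]; last exact: Fcontr.
  move=> i; rewrite -[x 1%N]/(F 1) /F scoefD scoefN scoef_natM presD presN pres_mul_l0.
  by rewrite subr0.
have /choice [z zE] i : exists y, forall k, pres y k = pres (scoef (x k) i) k.
  by apply: padic_limit => k; apply: xS.
exists (FPSeries z); apply: seriesP => i; apply: padicP => k.
transitivity (pres (scoef (x k.+1) i) k); first by rewrite xS -zE.
by apply: (Fweak k (x k)) => {}i; rewrite -zE.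
Qed.

(** Let [n] be the first index of a coefficient prime to [l], and write [f = l A + T^n U] with
    [U V = 1]. For the fixed point [z] and [B = z A V], one has [z V f = l B + T^n z] and
    [z = 1 - l * sshift n B]. The shift cancels the part of [l B] of degree at least [n], so [z V f]
    is [T^n] plus multiples of [l] in lower degrees. *)
Lemma weierstrass_preparation (f : fpseries Zl) k :
  pres (scoef f k) 0 != 0 -> exists g u, weierstrass f 0 g u.
Proof.
move=> fk; have exn : exists n, pres (scoef f n) 0 != 0 by exists k.
case: (ex_minnP exn) => n fn nmin {k fk exn}.
have [c fc] := padic_unitP fn.
(* From index [n] on the equation is trivial, so [choice] yields a total sequence. *)
have /choice [a aE] i :
    exists y, scoef f i = if (i < n)%N then l%:R * y else scoef f i.
  case: ltnP => [lt_in|_]; last by exists 0.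
  apply: padic_dvd_lP; apply/eqP; apply: contraTT lt_in => /nmin.
  by rewrite -leqNgt.
pose A : fpseries Zl := FPSeries (fun i => if (i < n)%N then a i else 0).
pose U := sshift n f.
have fE : f = l%:R * A + series_of 'X^n * U.
  apply: seriesP => i; rewrite scoefD scoef_natM scoef_mulXn /= aE.
  by case: ltnP => [|/subnKC ->]; rewrite ?addr0 // mulr0 add0r.
have [V UV] : exists V, U * V = 1 by apply: (@series_inv _ U c); rewrite /= addn0.
have [z zE] := sshift_fixpoint n (A * V).
set B := z * (A * V) in zE.
have qf : z * V * f = l%:R * B + series_of 'X^n * z.
  transitivity (l%:R * B + series_of 'X^n * z * (U * V)); last by rewrite UV mulr1.
  by rewrite fE /B; ring.
clearbody B.
(* The constant term of [z] is 1 modulo [l], so [z] is a unit. *)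
have [|c' zc'] := @padic_unitP (scoef z 0).
  by rewrite zE scoefD scoefN scoef_natM presD presN pres_mul_l0 subr0 scoef1.
have [z' zz'] := series_inv zc'.
pose r : {poly Zl} := \poly_(i < n) (l%:R * scoef B i).
pose g := 'X^n + r.
have size_r : (size r < n.+1)%N by rewrite ltnS size_poly.
have sg : size g = n.+1 by rewrite size_polyDl size_polyXn.
have gE : series_of g = z * V * f.
  rewrite qf; apply: seriesP => i.
  rewrite scoefD scoef_natM scoef_mulXn /= coefD coefXn coef_poly.
  case: ltnP => [lt_in|le_ni]; first by rewrite ltn_eqF // add0r addr0.
  rewrite zE scoefD scoefN scoef_natM /= subnKC //.
  by rewrite addr0 addrC subrK coef1 subn_eq0 eqn_leq le_ni andbT.
exists g, (U * z'); split.
- split; first by rewrite monicE lead_coefDl ?size_polyXn // lead_coefXn.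
  move=> i; rewrite sg /= => lt_in.
  by exists (scoef B i); rewrite coefD coefXn coef_poly lt_in ltn_eqF // add0r.
- exists (z * V); transitivity ((U * V) * (z * z')); first by ring.
  by rewrite UV zz' mulr1.
rewrite gE expr0 mul1r; transitivity (f * ((U * V) * (z * z'))); last by ring.
by rewrite UV zz' !mulr1.
Qed.

(** * The characteristic series modulo [l] *)

Lemma Zp_fermat (x : 'Z_(l ^ 1)) : x ^+ l.-1 = (x != 0)%:R.
Proof.
have l1_gt0 : (0 < l.-1)%N by rewrite -subn1 subn_gt0 prime_gt1.
have [->|nz_x] := eqVneq x 0; first by rewrite expr0n gtn_eqF.
have cop : coprime x l.
  rewrite coprime_sym prime_coprime //; apply: contra nz_x => dv.
  rewrite -[x]natr_Zp -[0]/(0%:R) (Zp_eq_nat l_prime).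
  by move: (x : nat) dv => N dv; rewrite expn1 mod0n.
rewrite -[x]natr_Zp -natrX; apply/eqP; rewrite (Zp_eq_nat l_prime).
move: (x : nat) cop => N cop.
by rewrite expn1 -totient_prime //; apply/eqP/Euler_exp_totient.
Qed.

Lemma size_ffact_poly (R : comNzRingType) k :
  size (\prod_(i < k) ('X - i%:R%:P : {poly R})) = k.+1.
Proof. by rewrite size_prod_XsubC [index_enum _]unlock -enumT size_enum_ord. Qed.

(** The factor [k!] clears the denominator of the binomial coefficient and leaves a falling
    factorial, whose residue depends only on that of [b]. *)
Lemma pres_binseries (b : Zl) k n :
  k`!%:R * pres (scoef (binseries b) k) n
  = (\prod_(i < k) ('X - i%:R%:P)).[pres b n].
Proof.
rewrite -(pres_nat l) -presM (padic_binP l_prime) horner_prod.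
elim: k => [|k IH]; first by rewrite !big_ord0.
rewrite !big_ord_recr presM; congr (_ * _); first exact: IH.
by rewrite presD presN pres_nat !hornerE.
Qed.

Lemma char_series_neq0 t (alpha : 'rV[Zl]_t) :
  odd l -> admissible alpha -> (t < l)%N ->
  exists k, pres (scoef (char_series alpha) k) 0 != 0.
Proof.
move=> odd_l adm lt_tl.
have scoef_sum (F : 'I_t -> fpseries Zl) k :
    scoef (\sum_j F j) k = \sum_j scoef (F j) k.
  by elim/big_rec2: _ => [//|i y1 y2 _ <-]; rewrite scoefD.
apply/not_existsP => f0.
pose a j : 'Z_(l ^ 1) := pres (alpha 0 j) 0.
pose L (p : {poly 'Z_(l ^ 1)}) := \sum_j (2 * p.[0] - p.[a j] - p.[- a j]).
have L0 : forall p, L p = 0.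
  apply: (@monic_basis_ind _ (fun k => \prod_(i < k) ('X - i%:R%:P))).
  - by move=> k; apply: monic_prod_XsubC.
  - exact: size_ffact_poly.
  - by rewrite /L big1 // => j _; rewrite !horner0 mulr0 !subr0.
  - move=> c p q Lp Lq; transitivity (c * L p + L q); last first.
      by rewrite Lp Lq mulr0 addr0.
    rewrite /L mulr_sumr -big_split; apply: eq_bigr => j _ /=.
    by rewrite !hornerD !hornerZ; ring.
  (* Going from coefficients to [L] only multiplies by [k!], so this also works for [k >= l], where
     [k!] is 0 modulo [l]. *)
  move=> k; transitivity (k`!%:R * pres (scoef (char_series alpha) k) 0).
    rewrite scoef_sum pres_sum mulr_sumr; apply: eq_bigr => j _.
    rewrite -[2 in RHS]mulr1 !scoefD !scoefN !presD !presN !mulrBr.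
    rewrite !pres_binseries; congr (_ - _ - _).
    (* The constant 2 of each summand matches [2 * p.[0]], as falling factorials of positive degree
       vanish at 0. *)
    rewrite scoef_natM scoef1 presM !pres_nat mulrCA.
    congr (_ * _); case: k => [|k]; first by rewrite big_ord0 hornerE mulr1.
    by rewrite big_ord_recl hornerM hornerXsubC subrr mul0r mulr0.
  by move/negP: (f0 k); rewrite negbK => /eqP ->; rewrite mulr0.
have l_gt1 := prime_gt1 l_prime.
(* Evenness of [l.-1] makes [a j] and [- a j] contribute equally. *)
have even_l1 : odd l.-1 = false by rewrite -subn1 oddB ?odd_l 1?ltnW.
pose c := #|[pred j | a j != 0]|.
have LX : L 'X^(l.-1) = - (2 * c)%:R.
  rewrite /L /c natrM -sum1_card natr_sum mulr_sumr [in RHS]big_mkcond -sumrN.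
  apply: eq_bigr => j _.
  rewrite !hornerXn exprNn -signr_odd even_l1 mul1r !Zp_fermat eqxx inE.
  by case: (a j != 0) => /=; ring.
have : (l %| 2 * c)%N.
  have := L0 'X^(l.-1); rewrite LX => /eqP; rewrite oppr_eq0.
  by rewrite -[0]/(0%:R) (Zp_eq_nat l_prime) expn1 mod0n.
rewrite Euclid_dvdM // dvdn_prime2 // => /orP[/eqP El|].
  by have := odd_l; rewrite El.
(* If [c] were 0, [l] would divide every voltage, against admissibility. *)
have c_gt0 : (0 < c)%N.
  rewrite lt0n; apply/eqP => /card0_eq c0; apply: adm => j.
  by apply: padic_dvd_lP; apply/eqP/negPn; move: (c0 j); rewrite !inE => ->.
move/(dvdn_leq c_gt0); rewrite leqNgt => /negP; apply.
by apply: leq_ltn_trans lt_tl; rewrite -[t in (_ <= t)%N]card_ord max_card.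
Qed.

End PadicIntegers.

Theorem corollary4p3 (l t : nat) (alpha : 'rV[padic_int l]_t) :
  prime l -> odd l -> 2 <= t -> admissible alpha -> t < l ->
  mu_bouquet alpha = Some 0.
Proof.
move=> l_prime odd_l _ adm lt_tl; apply/(mu_seriesP l_prime).
have [k fk] := char_series_neq0 l_prime odd_l adm lt_tl.
exact: weierstrass_preparation l_prime _ _ fk.
Qed.
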